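(* Let $T$ be a bounded linear operator on a complex Hilbert space $\mathcal{H}$ such that $W_s(T)$ has non-empty interior. (a) Suppose $0\in\partial W_s(T)$ is a point of infinite curvature of $W_s(T)$, and $W_s(T)$ is in standard position. If $(u_n)$ is a sequence of unit vectors in $\mathcal{H}$ such that $\langle Tu_n,u_n\rangle\to 0$, then $\|Tu_n\|\to 0$ and $\|T^*u_n\|\to 0$. (b) Suppose $0\in\partial W_s(T)$ is a point of infinite righthand (resp. lefthand) curvature of $W_s(T)$, and $W_s(T)$ is in standard position. If $(u_n)$ is a sequence of unit vectors in $\mathcal{H}$ such that $\langle Tu_n,u_n\rangle\to 0$ and, for some $\alpha_0\in W_s(T)$ with $\operatorname{Re}\alpha_0>0$ (resp. $\operatorname{Re}\alpha_0<0$), for every $n$ the number $\langle Tu_n,u_n\rangle$ is non-zero and lies in the segment with end points $0$ and $\alpha_0$, then $\|Tu_n\|\to 0$ and $\|T^*u_n\|\to 0$.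
   Context: The numerical range is $W(T)=\{\langle Tx,x\rangle : x\in\mathcal{H},\ \|x\|=1\}$. The state numerical range is $W_s(T)=\{\phi(T):\phi\in S(C^*(T))\}$, where $C^*(T)$ is the $C^*$-algebra generated by $T$ and the identity $I$, and $S(\mathcal{A})$ is the state space of the $C^*$-algebra $\mathcal{A}$. One has $W_s(T)=\overline{W(T)}$, a compact convex set. Let $C\subset\mathbb{C}$ be convex with non-empty interior. $C$ is in standard position (with respect to the boundary point $0\in\partial C$) if $C$ is contained in the closed upper half-plane $\{\operatorname{Im}\alpha\ge 0\}$, so that the real axis is a supporting line of $C$ at $0$. A point $\lambda\in\partial C$ is of infinite curvature if, after a suitable rotation and translation taking $\lambda$ to $0$ and putting $C$ in standard position, $$\lim_{\alpha\to 0,\ \alpha\in C}\frac{|\operatorname{Im}\alpha|}{(\operatorname{Re}\alpha)^2}=\infty .$$ If $C$ is in standard position and the real axis is the only tangent (i.e. supporting) line to $\partial C$ at $0$, then $0$ is a point of infinite lefthand curvature if $\frac{|\operatorname{Im}\alpha|}{(\operatorname{Re}\alpha)^2}\to\infty$ as $\alpha\to 0$ with $\alpha\in C$, $\operatorname{Re}\alpha<0$, and a point of infinite righthand curvature if the same holds as $\alpha\to 0$ with $\alpha\in C$, $\operatorname{Re}\alpha>0$. In these limits $\alpha\neq 0$, and the quotient is read as $+\infty$ when $\operatorname{Re}\alpha=0\ne\operatorname{Im}\alpha$. *)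

(* Defs.v *)
From mathcomp Require Import all_boot all_order all_algebra.
From mathcomp Require Import complex.
From mathcomp Require Import all_classical all_reals all_analysis.

Set Implicit Arguments.
Unset Strict Implicit.
Unset Printing Implicit Defensive.
Import Order.TTheory GRing.Theory Num.Theory.
Import numFieldNormedType.Exports.
Local Open Scope classical_set_scope.
Local Open Scope ring_scope.

(* The topology on the complex plane is the one of the normed module R[i]^o.
   Norms of vectors of a module over R[i] are elements of R[i] (with zero
   imaginary part), and [0 <= z] in R[i] means that z is real and
   nonnegative. *)

(* hdot is linear in its first argument and conjugate-linear in the second. *)
Record hilbertSpace (R : realType) := HilbertSpace {
  hilbert_sort :> completeNormedModType R[i] ;
  hdot : {dot hilbert_sort for (@Num.conj R[i])} ;
  hdot_norm : forall x : hilbert_sort, `|x| ^+ 2 = hdot x x }.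

Arguments hdot {R _}.

Section operators.
Variables (R : realType) (H : hilbertSpace R).
Implicit Types (A B T : H -> H) (S : set (H -> H)).

Definition bounded_operator A : Prop :=
  linear A /\ exists M : R, forall x : H, `|A x| <= M%:C%C * `|x|.

(* For a bounded linear A the set below is a singleton, by the Riesz representation
   theorem; the value of adjoint at other maps is irrelevant. *)
Definition adjoint A : H -> H :=
  xget (fun=> 0) [set B : H -> H | forall x y : H, hdot (A x) y = hdot x (B y)].

(* The last clause is closedness for the operator norm: ||A - B|| <= e is
   written pointwise. *)
Definition unital_Cstar_subalgebra S : Prop :=
  [/\ S `<=` bounded_operator,
      S id /\
      (forall (a : R[i]) A B, S A -> S B -> S (fun x => a *: A x + B x)),
      forall A B, S A -> S B -> S (A \o B),
      forall A, S A -> S (adjoint A) &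
      forall A, bounded_operator A ->
        (forall e : R, 0 < e -> exists2 B, S B &
           forall x : H, `|A x - B x| <= e%:C%C * `|x|) ->
        S A].

Definition Cstar T : set (H -> H) := smallest unital_Cstar_subalgebra [set T].

(* A functional on the algebra S is given by a map on all of H -> H, of which
   only the restriction to S matters. *)
Definition state S : set ((H -> H) -> R[i]) :=
  [set phi : (H -> H) -> R[i] |
    [/\ forall (a : R[i]) A B, S A -> S B ->
          phi (fun x => a *: A x + B x) = a * phi A + phi B,
        forall A, S A -> 0 <= phi (adjoint A \o A) &
        phi id = 1]].

Definition state_numerical_range T : set R[i]^o :=
  [set phi T | phi in state (Cstar T)].

End operators.

Section curvature.
Variable R : realType.
Implicit Types (C : set R[i]^o) (z : R[i]^o).

Definition boundary C : set R[i]^o := closure C `\` C°.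

Definition standard_position C : Prop :=
  boundary C 0 /\ C `<=` [set z | 0 <= complex.Im z].

(* Only used for z != 0, so that the first case has nonzero imaginary part. *)
Definition curvature_quotient z : \bar R :=
  if complex.Re z == 0 then +oo%E else (`|complex.Im z| / complex.Re z ^+ 2)%:E.

(* C' is the image of C under the rigid motion z |-> w (z - lambda). At a corner
   several such motions put C in standard position; one of them has to give an
   infinite limit. *)
Definition infinite_curvature C (lambda : R[i]^o) : Prop :=
  boundary C lambda /\
  exists w : R[i], `|w| = 1 /\
    let C' := [set w * (z - lambda) | z in C] : set R[i]^o in
    standard_position C' /\
    curvature_quotient @ within C' (0 : R[i]^o)^' --> +oo%E.

(* The line through 0 in direction v != 0 supports C, with C lying in the
   closed half-plane to the left of v; replacing v by - v gives the other
   half-plane. *)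
Definition supporting_direction C (v : R[i]) : Prop :=
  v != 0 /\ forall z, C z -> 0 <= complex.Im (Num.conj v * z).

Definition real_axis_only_tangent C : Prop :=
  forall v : R[i], supporting_direction C v -> complex.Im v = 0.

Definition infinite_righthand_curvature C : Prop :=
  [/\ standard_position C, real_axis_only_tangent C &
      curvature_quotient @ within (C `&` [set z | 0 < complex.Re z]) (0 : R[i]^o)^'
        --> +oo%E].

Definition infinite_lefthand_curvature C : Prop :=
  [/\ standard_position C, real_axis_only_tangent C &
      curvature_quotient @ within (C `&` [set z | complex.Re z < 0]) (0 : R[i]^o)^'
        --> +oo%E].

Definition segment0 (a : R[i]) : set R[i] :=
  [set t%:C%C * a | t in `[0 : R, 1]].

End curvature.

(* Main.v *)
Require Import Defs.
From mathcomp Require Import all_boot all_order all_algebra.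
From mathcomp Require Import complex.
From mathcomp Require Import all_classical all_reals all_analysis.
From mathcomp Require Import ring lra.
Set Implicit Arguments.
Unset Strict Implicit.
Unset Printing Implicit Defensive.
Import Order.TTheory GRing.Theory Num.Theory.
Import numFieldNormedType.Exports.
Local Open Scope classical_set_scope.
Local Open Scope ring_scope.

(** Infinite curvature at 0 says that a point [z] of the range close to 0
    satisfies [(Re z)^2 <= e * Im z] with [e] as small as desired.  Perturb a
    unit vector [u], at which [<Tu,u>] is nearly 0, by [s v] with [|v| <= 1] and
    [|s| = r] small.  Then
      [<T(u + s v), u + s v> = <Tu,u> + L(s) + r^2 <Tv,v>],
      [L(s) = s <Tv,u> + s^* <Tu,v>],
    and this number, up to a factor bounded above and below, is again in the
    range.  The linear term has order [r] and the others have order [r^2],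
    provided that [<Tu,u>] has been made smaller than [r^2].

    The range lies in the upper half-plane, so both signs of [s] give
    [Im L(s) = O(r^2)].  Thus the imaginary part of the perturbed value is
    [O(r^2)], and by curvature its real part is [O(r sqrt e)], hence so is
    [Re L(s)].  Since [Re L(- s) = - Re L(s)], it is enough to control the real
    part when it has one given sign; this is why one-sided infinite curvature
    suffices.  Altogether [|L(s)| <= o(1) r] ([linear_term_small]).

    Taking [s = r] and [s = i r] separates the two summands of [L], so [<Tu,v>]
    and [<Tv,u>] are small uniformly in [v] ([offdiagonal_small]).  With [v] the
    normalisation of [Tu], respectively of [T^* u], this is the smallness of the
    norms [|Tu|] and [|T^* u|] ([norms_vanish]).

    Vector states put [<Tx,x>] in the state numerical range
    ([numerical_range_sub]), and the limits that define curvature become the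
    inequality above ([infinite_curvature_on_cvg]).  At a corner the range has
    several standard positions, of which only some may have an infinite limit;
    [T] is first multiplied by the unimodular [w] leading to such a position. *)

(** * Real and imaginary parts of complex numbers *)

Section Norms.
Variable R : realType.
Implicit Types z : R[i].

Lemma normc_le_sqr z (b : R) : 0 <= b ->
  (`|z| <= b%:C%C) = (complex.Re z ^+ 2 + complex.Im z ^+ 2 <= b ^+ 2).
Proof.
move=> b0; rewrite -(@ler_pXn2r _ 2) // ?nnegrE ?ler0c // -add_Re2_Im2.
by rewrite -rmorphXn /= lecR.
Qed.

Lemma abs_Re_le z (b : R) : `|z| <= b%:C%C -> `|complex.Re z| <= b.
Proof. by move=> zb; rewrite -lecR; apply: le_trans zb; exact: normc_ge_Re. Qed.

Lemma abs_Im_le z (b : R) : `|z| <= b%:C%C -> `|complex.Im z| <= b.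
Proof.
move=> zb; have b0 : 0 <= b by rewrite -ler0c (le_trans _ zb).
move: zb; rewrite normc_le_sqr // => zb.
rewrite -(@ler_pXn2r _ 2) ?nnegrE // real_normK ?num_real //.
by apply: le_trans zb; rewrite lerDr sqr_ge0.
Qed.

Lemma normc_le_ReIm z (a b : R) :
  `|complex.Re z| <= a -> `|complex.Im z| <= b -> `|z| <= (a + b)%:C%C.
Proof.
move=> za zb; have a0 := le_trans (normr_ge0 _) za.
have b0 := le_trans (normr_ge0 _) zb.
rewrite normc_le_sqr ?addr_ge0 // -(real_normK (num_real (complex.Re z))).
rewrite -(real_normK (num_real (complex.Im z))).
have := normr_ge0 (complex.Re z); have := normr_ge0 (complex.Im z); nra.
Qed.

Lemma Re_realM (a : R) z : complex.Re (a%:C%C * z) = a * complex.Re z.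
Proof. by case: z => x y /=; rewrite mul0r subr0. Qed.
Lemma Im_realM (a : R) z : complex.Im (a%:C%C * z) = a * complex.Im z.
Proof. by case: z => x y /=; rewrite mul0r addr0. Qed.
Lemma ReD z1 z2 : complex.Re (z1 + z2) = complex.Re z1 + complex.Re z2.
Proof. by case: z1 z2 => [? ?] [? ?]. Qed.
Lemma ImD z1 z2 : complex.Im (z1 + z2) = complex.Im z1 + complex.Im z2.
Proof. by case: z1 z2 => [? ?] [? ?]. Qed.
Lemma ReN z : complex.Re (- z) = - complex.Re z.
Proof. by case: z. Qed.
Lemma ImN z : complex.Im (- z) = - complex.Im z.
Proof. by case: z. Qed.

(** The estimate on the linear term [L], for [z] and [r^2 w] of order [r^2]; [sg]
    is the sign of the real parts on which the curvature bound is known.  The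
    factor 4 in that bound leaves room for a rescaling by the square of a norm
    not exceeding 2. *)
Lemma linear_term_small (sg r M k e : R) z L w :
  sg ^+ 2 = 1 -> 0 < r -> 1 <= M -> 0 < k -> 0 < e ->
  M * r <= k -> e * M <= k ^+ 2 ->
  `|z| <= (r ^+ 2)%:C%C -> `|w| <= M%:C%C ->
  (forall X, X = z + L + (r ^+ 2)%:C%C * w \/ X = z - L + (r ^+ 2)%:C%C * w ->
     0 <= complex.Im X /\
     (0 < sg * complex.Re X -> complex.Re X ^+ 2 <= 4 * e * complex.Im X)) ->
  `|L| <= (8 * k * r)%:C%C.
Proof.
move=> sg1 r0 M1 k0 e0 Mrk eMk zr wM HX.
have [I1 R1] := HX _ (or_introl erefl).
have [I2 R2] := HX _ (or_intror erefl).
rewrite !(ReD, ImD, ReN, ImN, Re_realM, Im_realM) in I1 I2 R1 R2.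
move: (abs_Re_le zr) (abs_Im_le zr) (abs_Re_le wM) (abs_Im_le wM).
move: I1 I2 R1 R2 => {zr wM HX}.
move: (complex.Re z) (complex.Im z) (complex.Re w) (complex.Im w) => a b c d.
have : `|L| <= (`|complex.Re L| + `|complex.Im L|)%:C%C by exact: normc_le_ReIm.
move: (complex.Re L) (complex.Im L) => p q nL.
move=> I1 I2 R1 R2; rewrite !ler_norml.
move=> /andP[a1 a2] /andP[b1 b2] /andP[c1 c2] /andP[d1 d2].
apply: (le_trans nL); rewrite lecR {nL}.
have rk : M * r ^+ 2 <= k * r by nra.
have r2M : r ^+ 2 <= M * r ^+ 2 by nra.
have c1' : - (M * r ^+ 2) <= r ^+ 2 * c by nra.
have c2' : r ^+ 2 * c <= M * r ^+ 2 by nra.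
have d1' : - (M * r ^+ 2) <= r ^+ 2 * d by nra.
have d2' : r ^+ 2 * d <= M * r ^+ 2 by nra.
(* The upper half-plane condition at both signs bounds [Im L]. *)
have q1 : `|q| <= 2 * (k * r) by rewrite ler_norml; lra.
have kr : 0 < k * r by exact: mulr_gt0.
(* Curvature bounds the real part where its sign is that of [sg]; elsewhere the
   bound is trivial. *)
have bnd Re Im : Im <= 4 * (M * r ^+ 2) ->
  (0 < sg * Re -> Re ^+ 2 <= 4 * e * Im) -> sg * Re <= 4 * (k * r).
  move=> Iu hR; have [|pos] := leP (sg * Re) 0; first by move=> ?; lra.
  rewrite -(@ler_pXn2r _ 2) ?nnegrE //; [| exact: ltW | lra].
  rewrite exprMn sg1 mul1r; apply: (le_trans (hR pos)).
  have -> : (4 * (k * r)) ^+ 2 = 16 * (k ^+ 2 * r ^+ 2) by ring.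
  apply: (@le_trans _ _ (4 * e * (4 * (M * r ^+ 2)))).
    by rewrite ler_pM2l //; lra.
  have -> : 4 * e * (4 * (M * r ^+ 2)) = 16 * ((e * M) * r ^+ 2) by ring.
  by rewrite ler_pM2l // ler_pM2r // exprn_gt0.
have /andP[q2 q3] : - (2 * (M * r ^+ 2)) <= q <= 2 * (M * r ^+ 2) by lra.
(* Adding and subtracting [L] turns the one-sided bound into a two-sided one. *)
have S1 : sg * (a + p + r ^+ 2 * c) <= 4 * (k * r) by apply: (bnd _ _ _ R1); lra.
have S2 : sg * (a - p + r ^+ 2 * c) <= 4 * (k * r) by apply: (bnd _ _ _ R2); lra.
have p1 : `|p| <= 6 * (k * r).
  have /orP[/eqP es|/eqP es] : (sg == 1) || (sg == -1).
      by rewrite -sqrf_eq1; apply/eqP.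
    by rewrite ler_norml; rewrite es in S1 S2; lra.
  by rewrite ler_norml; rewrite es in S1 S2; lra.
lra.
Qed.

End Norms.

(** * Hilbert space *)

Section Hilbert.
Variables (R : realType) (H : hilbertSpace R).
Implicit Types (x y : H) (T : H -> H).

Lemma hdotC x y : hdot x y = (hdot y x)^*.
Proof. by rewrite hermC expr0 mul1r. Qed.

Lemma hdotDl x y z : hdot (x + y) z = hdot x z + hdot y z.
Proof. exact: linearDl. Qed.
Lemma hdotDr x y z : hdot x (y + z) = hdot x y + hdot x z.
Proof. exact: linearDr. Qed.
Lemma hdotZl (a : R[i]) x y : hdot (a *: x) y = a * hdot x y.
Proof. exact: linearZl_LR. Qed.
Lemma hdotZr (a : R[i]) x y : hdot x (a *: y) = a^* * hdot x y.
Proof. exact: linearZr_LR. Qed.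

(** Positivity of the square norm of [a x - c y] for [a = <y,y>], [c = <x,y>]. *)
Lemma hdot_cauchy_schwarz x y : `|hdot x y| <= `|x| * `|y|.
Proof.
have [->|y0] := eqVneq y 0; first by rewrite linear0r normr0 mulr_ge0.
set c := hdot x y; set a := hdot y y.
have ea : a = `|y| ^+ 2 by rewrite /a -hdot_norm.
have a0 : 0 < a by rewrite ea exprn_gt0 // normr_gt0.
have ca : a^* = a by apply/CrealP; rewrite realE ltW.
have : 0 <= hdot (a *: x + (- c) *: y) (a *: x + (- c) *: y).
  by rewrite -hdot_norm exprn_ge0.
have -> : hdot (a *: x + (- c) *: y) (a *: x + (- c) *: y)
   = a * ((`|x| * `|y|) ^+ 2 - `|c| ^+ 2).
  rewrite !(hdotDl, hdotDr, hdotZl, hdotZr) (hdotC y x) -/c -/a.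
  rewrite rmorphN ca normCK exprMn -ea hdot_norm; ring.
by rewrite pmulr_rge0 // subr_ge0 ler_pXn2r // nnegrE mulr_ge0.
Qed.

Lemma linear_apply T : linear T ->
  (forall (a : R[i]) x, T (a *: x) = a *: T x) /\
  (forall x y, T (x + y) = T x + T y).
Proof.
move=> linT; have TD x y : T (x + y) = T x + T y.
  by rewrite -[x in LHS]scale1r linT scale1r.
split=> // a x; rewrite -[a *: x]addr0 linT; suff -> : T 0 = 0 by rewrite addr0.
by apply: (@addrI _ (T 0)); rewrite -TD !addr0.
Qed.

Lemma bounded_form T : bounded_operator T ->
  exists2 M : R, 1 <= M &
    forall x y : H, `|hdot (T x) y| <= M%:C%C * (`|x| * `|y|).
Proof.
move=> [_ [M hM]]; exists (Num.max 1 M); first by rewrite le_max lexx.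
move=> x y; apply: (le_trans (hdot_cauchy_schwarz _ _)).
rewrite mulrA ler_wpM2r //; apply: (le_trans (hM x)).
by rewrite ler_wpM2r // lecR le_max lexx orbT.
Qed.

(** By definition [adjoint T] is the null map if [T] has no adjoint.  The
    values and norms of [adjoint T] that appear below are then 0, so the bounds
    required of them hold in both cases. *)
Lemma adjointP T :
  adjoint T = (fun=> 0) \/ forall x y : H, hdot (T x) y = hdot x (adjoint T y).
Proof. by rewrite /adjoint; case: xgetP => [B _|_]; [right|left]. Qed.

Lemma norming_vector (y : H) :
  exists2 v : H, `|v| <= 1 & hdot y v = `|y| /\ hdot v y = `|y|.
Proof.
have [->|y0] := eqVneq y 0.
  by exists 0; rewrite ?normr0 ?ler01 // linear0r.
have ny : `|y| != 0 by rewrite normr_eq0.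
exists (`|y|^-1 *: y); first by rewrite normrZ ger0_norm ?invr_ge0 // mulVf.
rewrite hdotZl hdotZr -hdot_norm conj_Creal ?rpredV ?normr_real //.
by split; rewrite expr2 mulKf.
Qed.

(** The map [A |-> <Ax,x>] is a state of the algebra generated by [T]. *)
Lemma numerical_range_sub T (x : H) : `|x| = 1 ->
  state_numerical_range T (hdot (T x) x).
Proof.
move=> x1; exists (fun A => hdot (A x) x) => //; split.
- by move=> a A B _ _; rewrite hdotDl hdotZl.
- move=> A _ /=; have [->|adjA] := adjointP A.
    by rewrite linear0l.
  by rewrite hdotC -adjA -hdot_norm conj_ge0 exprn_ge0.
- by rewrite -hdot_norm x1 expr1n.
Qed.

End Hilbert.

(** * Infinite curvature on one side *)

(** The sign [sg] is 1 for the righthand side and -1 for the lefthand side. *)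
Definition infinite_curvature_on (R : realType) (C : set R[i]) (sg : R) : Prop :=
  forall e : R, 0 < e -> exists2 d : R, 0 < d &
    forall z, C z -> `|z| < d%:C%C -> 0 < sg * complex.Re z ->
      complex.Re z ^+ 2 <= e * complex.Im z.

(** The same statement serves for the two-sided limit ([D] equal to [C]) and for
    the two one-sided ones. *)
Lemma infinite_curvature_on_cvg (R : realType) (C D : set R[i]^o) (sg : R) :
  (forall z, C z -> 0 <= complex.Im z) ->
  (forall z, C z -> 0 < sg * complex.Re z -> D z) ->
  curvature_quotient (R := R) @ within D (0 : R[i]^o)^' --> +oo%E ->
  infinite_curvature_on C sg.
Proof.
move=> Cpos CD /cvgeyPge lim e e0.
have /nbhs_ballP[d /= d0 hd] := lim e^-1.
have /complex_realP[d' dE] := gtr0_real d0.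
exists d'; first by move: d0; rewrite dE ltcR.
move=> z Cz zd sz.
have z0 : complex.Re z != 0 by apply: contraTneq sz => ->; rewrite mulr0 ltxx.
have := hd z; rewrite /ball /= sub0r normrN dE => /(_ zd) hz.
have {}hz : (e^-1%:E <= curvature_quotient z)%E.
  by apply: hz; [apply: contraNneq z0 => ->|exact: CD].
move: hz; rewrite /curvature_quotient (negPf z0) lee_fin ger0_norm ?Cpos //.
have Re2 : 0 < complex.Re z ^+ 2 by rewrite exprn_even_gt0.
by rewrite ler_pdivlMr // ler_pdivrMl.
Qed.

(** * Perturbation of unit vectors *)

Section Estimates.
Variables (R : realType) (H : hilbertSpace R).
Implicit Types (T : H -> H) (C : set R[i]).

(** Rescaling to the unit sphere: [<Tx,x>] is [|x|^2] times a point of [C], and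
    [|x|^2] is between 1/4 and 4. *)
Lemma infinite_curvature_on_homogeneous T C (sg : R) : linear T ->
  (forall x : H, `|x| = 1 -> C (hdot (T x) x)) ->
  (forall z, C z -> 0 <= complex.Im z) -> infinite_curvature_on C sg ->
  forall e : R, 0 < e -> exists2 d : R, 0 < d &
    forall x : H, (2^-1)%:C%C <= `|x| <= (2 : R)%:C%C ->
      `|hdot (T x) x| < d%:C%C ->
      0 <= complex.Im (hdot (T x) x) /\
      (0 < sg * complex.Re (hdot (T x) x) ->
       complex.Re (hdot (T x) x) ^+ 2 <= 4 * e * complex.Im (hdot (T x) x)).
Proof.
move=> linT CT Cpos curv e e0; have [d d0 hd] := curv e e0.
exists (d / 4); first by rewrite divr_gt0.
move=> x; have -> : `|x| = (complex.Re `|x|)%:C%C by rewrite RRe_real ?normr_real.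
set n := complex.Re `|x|; rewrite !lecR => /andP[n1 n2].
have n0 : 0 < n by lra.
have nx : `|x| = n%:C%C by rewrite /n RRe_real ?normr_real.
set y : H := (n^-1)%:C%C *: x.
have y1 : `|y| = 1.
  rewrite normrZ nx ger0_norm ?ler0c ?invr_ge0 ?ltW // -rmorphM /= mulVf //.
  exact: lt0r_neq0.
have [TZ _] := linear_apply linT.
have -> : hdot (T x) x = (n ^+ 2)%:C%C * hdot (T y) y.
  have -> : x = n%:C%C *: y.
    by rewrite scalerA -rmorphM /= mulfV ?scale1r // lt0r_neq0.
  rewrite TZ hdotZl hdotZr mulrA; congr (_ * _).
  have /CrealP -> : n%:C%C \is Num.real by apply/complex_realP; exists n.
  by rewrite rmorphXn.
have n2lo : 1 <= n ^+ 2 * 4.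
  have h2 : 1 <= n * 2 by lra.
  have -> : n ^+ 2 * 4 = (n * 2) * (n * 2) by ring.
  nra.
have n2hi : n ^+ 2 <= 4 by nra.
have n2pos : 0 < n ^+ 2 by rewrite exprn_gt0.
rewrite Re_realM Im_realM normrM (@ger0_norm _ (n ^+ 2)%:C%C) ?ler0c ?sqr_ge0 //.
move=> small.
have Cy := CT _ y1.
have Ypos := Cpos _ Cy.
split; first by rewrite mulr_ge0 // ltW.
have ysmall : `|hdot (T y) y| < d%:C%C.
  rewrite -(@ltr_pM2l _ (n ^+ 2)%:C%C) ?ltcR //.
  by apply: (lt_le_trans small); rewrite -rmorphM lecR ler_pdivrMr //; nra.
rewrite mulrCA pmulr_rgt0 // => /(hd _ Cy ysmall).
move: (complex.Re _) (complex.Im _) Ypos => a b b0 ab.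
rewrite exprMn.
have h1 : n ^+ 2 * (a ^+ 2) <= 4 * e * b.
  apply: (@le_trans _ _ (n ^+ 2 * (e * b))); first by rewrite ler_pM2l.
  have : 0 <= e * b by rewrite mulr_ge0 // ltW.
  nra.
have -> : (n ^+ 2) ^+ 2 * a ^+ 2 = n ^+ 2 * (n ^+ 2 * a ^+ 2) by ring.
have -> : 4 * e * (n ^+ 2 * b) = n ^+ 2 * (4 * e * b) by ring.
by rewrite ler_pM2l.
Qed.

Lemma form_perturbation T (u v : H) (t : R[i]) : linear T ->
  hdot (T (u + t *: v)) (u + t *: v) =
  hdot (T u) u + (t * hdot (T v) u + t^* * hdot (T u) v) +
  `|t| ^+ 2 * hdot (T v) v.
Proof.
move=> /linear_apply[TZ TD].
by rewrite TD TZ !(hdotDl, hdotDr, hdotZl, hdotZr) normCK; ring.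
Qed.

(** At a unit vector [u] where the form is nearly 0, both [Tu] and [T^* u] are
    weakly small, uniformly over the unit ball. *)
Lemma offdiagonal_small T C (sg : R) : sg ^+ 2 = 1 -> bounded_operator T ->
  (forall x : H, `|x| = 1 -> C (hdot (T x) x)) ->
  (forall z, C z -> 0 <= complex.Im z) -> infinite_curvature_on C sg ->
  forall eta : R, 0 < eta -> exists2 d : R, 0 < d &
    forall u v : H, `|u| = 1 -> `|v| <= 1 -> `|hdot (T u) u| <= d%:C%C ->
      `|hdot (T u) v| <= eta%:C%C /\ `|hdot (T v) u| <= eta%:C%C.
Proof.
move=> sg1 bT CT Cpos curv eta eta0.
have [k k0 ->] : exists2 k : R, 0 < k & eta = 8 * k.
  by exists (eta / 8); [rewrite divr_gt0 | field].
have [linT _] := bT; have [M M1 hM] := bounded_form bT.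
have M0 : 0 < M by lra.
have M0c : 0 <= M%:C%C by rewrite ler0c ltW.
pose e := k ^+ 2 / M.
have e0 : 0 < e by rewrite divr_gt0 // exprn_gt0.
have eM : e * M <= k ^+ 2 by rewrite /e divfK // lt0r_neq0.
have [d d0 hd] := infinite_curvature_on_homogeneous linT CT Cpos curv e0.
(* The three bounds give a norm of [u + s v] between 1/2 and 3/2, the domination
   of [r^2 M] by [k r], and values of the form within the reach [d] of the
   curvature bound. *)
pose r := Num.min 2^-1 (Num.min (k / M) (d / (8 * M))).
have r0 : 0 < r by rewrite !lt_min invr_gt0 ltr0n !divr_gt0 // mulr_gt0.
have r0c : 0 <= r%:C%C by rewrite ler0c ltW.
have r1 : r <= 2^-1 by rewrite ge_min lexx.
have rk : M * r <= k.
  by rewrite mulrC -ler_pdivlMr // !ge_min lexx orbT.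
have rd : r * (8 * M) <= d.
  by rewrite -ler_pdivlMr ?mulr_gt0 // !ge_min lexx !orbT.
exists (r ^+ 2); first by rewrite exprn_gt0.
move=> u v u1 v1 zr; set q := hdot (T v) u; set p := hdot (T u) v.
have wM : `|hdot (T v) v| <= M%:C%C.
  apply: (le_trans (hM _ _)); rewrite ler_piMr //.
  by rewrite mulr_ile1.
have qM : `|q| <= M%:C%C.
  by apply: (le_trans (hM _ _)); rewrite u1 mulr1 ler_piMr.
have pM : `|p| <= M%:C%C.
  by apply: (le_trans (hM _ _)); rewrite u1 mul1r ler_piMr.
have form t : `|t| = r%:C%C ->
    hdot (T (u + t *: v)) (u + t *: v) =
      hdot (T u) u + (t * q + t^* * p) + (r ^+ 2)%:C%C * hdot (T v) v.
  by move=> tr; rewrite form_perturbation // tr -rmorphXn.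
have hX t : `|t| = r%:C%C -> let X := hdot (T (u + t *: v)) (u + t *: v) in
    0 <= complex.Im X /\
    (0 < sg * complex.Re X -> complex.Re X ^+ 2 <= 4 * e * complex.Im X).
  move=> tr X; apply: hd.
    have tv : `|t *: v| <= (2^-1)%:C%C.
      rewrite normrZ tr; apply: (@le_trans _ _ r%:C%C); last by rewrite lecR.
      by rewrite ler_piMr.
    apply/andP; split.
      have := lerB_normD u (t *: v); rewrite u1; apply: le_trans.
      rewrite lerBrDr; apply: (le_trans (lerD (lexx _) tv)).
      by rewrite -rmorphD /= (_ : 1 = 1%:C%C) // lecR; lra.
    apply: (le_trans (ler_normD _ _)); rewrite u1.
    apply: (le_trans (lerD (lexx _) tv)).
    by rewrite (_ : 1 = 1%:C%C) // -rmorphD lecR; lra.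
  rewrite form //.
  apply: (@le_lt_trans _ _ ((r ^+ 2)%:C%C + (r%:C%C * M%:C%C + r%:C%C * M%:C%C)
      + (r ^+ 2)%:C%C * M%:C%C)).
    apply: (le_trans (ler_normD _ _)); apply: lerD.
      apply: (le_trans (ler_normD _ _)); apply: lerD => //.
      apply: (le_trans (ler_normD _ _)); rewrite !normrM norm_conjC tr.
      by apply: lerD; apply: ler_wpM2l; rewrite //.
    by rewrite normrM (@ger0_norm _ (r ^+ 2)%:C%C) ?ler_wpM2l // ler0c sqr_ge0.
  by rewrite -!rmorphM -!rmorphD ltcR /=; nra.
have bnd s : `|s| = r%:C%C -> `|s * q + s^* * p| <= (8 * k * r)%:C%C.
  move=> sr; apply: (linear_term_small sg1 r0 M1 k0 e0 rk eM zr wM) => X [] ->.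
    by rewrite -form //; exact: hX.
  have -> : hdot (T u) u - (s * q + s^* * p) + (r ^+ 2)%:C%C * hdot (T v) v =
      hdot (T (u + (- s) *: v)) (u + (- s) *: v).
    by rewrite form ?normrN // rmorphN; ring.
  by apply: hX; rewrite normrN.
have scal x : `|r%:C%C * x| <= (8 * k * r)%:C%C -> `|x| <= (8 * k)%:C%C.
  rewrite normrM ger0_norm // mulrC rmorphM /= ler_pM2r //.
  by rewrite ltcR.
have rC : (r%:C%C)^* = r%:C%C by apply/CrealP/complex_realP; exists r.
(* The choices [s = r] and [s = i r] isolate [q + p] and [q - p]. *)
have addn : `|q + p| <= (8 * k)%:C%C.
  apply: scal; rewrite mulrDr -[X in _ + X * p]rC; apply: bnd.
  by rewrite ger0_norm.
have subn : `|q - p| <= (8 * k)%:C%C.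
  have ir : `|'i * r%:C%C| = r%:C%C by rewrite normrM normCi mul1r ger0_norm.
  apply: scal; have := bnd _ ir.
  have -> : 'i * r%:C%C * q + ('i * r%:C%C)^* * p = 'i * (r%:C%C * (q - p)).
    by rewrite rmorphM /= conjCi rC; ring.
  by rewrite normrM normCi mul1r.
have avg x a b : x = 2^-1 * (a + b) ->
    `|a| <= (8 * k)%:C%C -> `|b| <= (8 * k)%:C%C -> `|x| <= (8 * k)%:C%C.
  move=> -> ha hb; rewrite normrM ger0_norm ?invr_ge0 ?ler0n //.
  rewrite mulrC ler_pdivrMr ?ltr0n // mulrDr mulr1.
  by apply: (le_trans (ler_normD _ _)); exact: lerD.
split.
  by apply: (avg p (q + p) (- (q - p))); rewrite ?normrN //; field.
by apply: (avg q (q + p) (q - p)); rewrite //; field.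
Qed.

(** Here [C] contains the range of the rotated operator [w T], which has the same
    norms as [T]; the rotation is needed at a corner of the range, where the
    curvature limit may hold in a standard position other than the given one. *)
Lemma norms_vanish T C (w : R[i]) (sg : R) :
  `|w| = 1 -> sg ^+ 2 = 1 -> bounded_operator T ->
  (forall x : H, `|x| = 1 -> C (w * hdot (T x) x)) ->
  (forall z, C z -> 0 <= complex.Im z) -> infinite_curvature_on C sg ->
  forall u : nat -> H, (forall n, `|u n| = 1) ->
    ((hdot (T (u n)) (u n) : R[i]^o) @[n --> \oo] --> (0 : R[i]^o)) ->
    ((`|T (u n)| : R[i]^o) @[n --> \oo] --> (0 : R[i]^o)) /\
    ((`|adjoint T (u n)| : R[i]^o) @[n --> \oo] --> (0 : R[i]^o)).
Proof.
move=> w1 sg1 [linT [M hM]] CT Cpos curv u u1 u0.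
have bwT : bounded_operator (fun x => w *: T x).
  split=> [a x y|]; first by rewrite linT scalerDr !scalerA mulrC.
  by exists M => x; rewrite normrZ w1 mul1r.
have CwT x : `|x| = 1 -> C (hdot (w *: T x) x) by rewrite hdotZl; exact: CT.
have small (e : R) : 0 < e -> \forall n \near \oo, forall v : H, `|v| <= 1 ->
    `|hdot (T (u n)) v| <= e%:C%C /\ `|hdot (T v) (u n)| <= e%:C%C.
  move=> e0; have [d d0 hd] := offdiagonal_small sg1 bwT CwT Cpos curv e0.
  have dC : 0 < d%:C%C by rewrite ltcR.
  have /cvgr0Pnorm_le/(_ _ dC) := u0.
  apply: filterS => n nd v v1.
  have [] := hd (u n) v (u1 n) v1; first by rewrite hdotZl normrM w1 mul1r.
  by rewrite !hdotZl !normrM w1 !mul1r.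
have realpos (e : R[i]) : 0 < e -> exists2 e' : R, 0 < e' & e = e'%:C%C.
  move=> e0; have := gtr0_real e0; move=> /complex_realP[k ek].
  by exists k => //; move: e0; rewrite ek ltcR.
split; apply/cvgr0Pnorm_le => _ /realpos[e e0 ->];
  apply: filterS (small e e0) => n hn.
  have [v v1 [<- _]] := norming_vector (T (u n)).
  by have [] := hn v v1.
have [->|adjT] := adjointP T; first by rewrite !normr0 ler0c ltW.
have [v v1 [_ <-]] := norming_vector (adjoint T (u n)).
by rewrite -adjT; have [] := hn v v1.
Qed.

End Estimates.

Theorem theorem7 (R : realType) (H : hilbertSpace R) (T : H -> H)
    (bT : bounded_operator T)
    (intW : interior (state_numerical_range T) !=set0) :
  (infinite_curvature (state_numerical_range T) 0 ->
   standard_position (state_numerical_range T) ->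
   forall u : nat -> H, (forall n, `|u n| = 1) ->
     ((hdot (T (u n)) (u n) : R[i]^o) @[n --> \oo] --> (0 : R[i]^o)) ->
     ((`|T (u n)| : R[i]^o) @[n --> \oo] --> (0 : R[i]^o)) /\
     ((`|adjoint T (u n)| : R[i]^o) @[n --> \oo] --> (0 : R[i]^o)))
  /\
  (infinite_righthand_curvature (state_numerical_range T) ->
   standard_position (state_numerical_range T) ->
   forall u : nat -> H, (forall n, `|u n| = 1) ->
     ((hdot (T (u n)) (u n) : R[i]^o) @[n --> \oo] --> (0 : R[i]^o)) ->
     (exists alpha0 : R[i],
        [/\ state_numerical_range T alpha0, 0 < complex.Re alpha0 &
            forall n, hdot (T (u n)) (u n) != 0 /\
                      segment0 alpha0 (hdot (T (u n)) (u n))]) ->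
     ((`|T (u n)| : R[i]^o) @[n --> \oo] --> (0 : R[i]^o)) /\
     ((`|adjoint T (u n)| : R[i]^o) @[n --> \oo] --> (0 : R[i]^o)))
  /\
  (infinite_lefthand_curvature (state_numerical_range T) ->
   standard_position (state_numerical_range T) ->
   forall u : nat -> H, (forall n, `|u n| = 1) ->
     ((hdot (T (u n)) (u n) : R[i]^o) @[n --> \oo] --> (0 : R[i]^o)) ->
     (exists alpha0 : R[i],
        [/\ state_numerical_range T alpha0, complex.Re alpha0 < 0 &
            forall n, hdot (T (u n)) (u n) != 0 /\
                      segment0 alpha0 (hdot (T (u n)) (u n))]) ->
     ((`|T (u n)| : R[i]^o) @[n --> \oo] --> (0 : R[i]^o)) /\
     ((`|adjoint T (u n)| : R[i]^o) @[n --> \oo] --> (0 : R[i]^o))).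
Proof.
have WT x : `|x| = 1 -> state_numerical_range T (1 * hdot (T x) x).
  by rewrite mul1r; exact: numerical_range_sub.
split; [|split].
- move=> [_ [w [w1 [[_ Cpos] lim]]]] _ u u1 u0.
  apply: (@norms_vanish _ _ T _ w 1 w1 (expr1n _ 2) bT _ Cpos _ u u1 u0).
    move=> x x1; exists (hdot (T x) x); first exact: numerical_range_sub.
    by rewrite subr0.
  by apply: infinite_curvature_on_cvg Cpos _ lim.
- move=> [[_ Cpos] _ lim] _ u u1 u0 _.
  apply: (@norms_vanish _ _ T _ 1 1 (normr1 _) (expr1n _ 2) bT WT Cpos _ u u1 u0).
  by apply: infinite_curvature_on_cvg Cpos _ lim => z Cz; rewrite mul1r.
- move=> [[_ Cpos] _ lim] _ u u1 u0 _.
  apply: (@norms_vanish _ _ T _ 1 (-1) (normr1 _) _ bT WT Cpos _ u u1 u0).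
    by rewrite sqrrN expr1n.
  by apply: infinite_curvature_on_cvg Cpos _ lim => z Cz; rewrite mulN1r oppr_gt0.
Qed.
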